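(* (a) For $\Gamma=\operatorname{PSL}_2(\mathbb{Z})$ one has $\operatorname{LG}(\Gamma)=1$; in particular $\operatorname{PSL}_2(\mathbb{Z})$ is a bounded gaps group. (b) For every integer $N\ge 2$, the principal congruence subgroup $\Gamma(N)$ is a bounded gaps group, i.e. $0<\operatorname{LG}(\Gamma(N))<\infty$.
   Context: For an increasing sequence $(x_n)$ of positive reals ($x_{n+1}>x_n$), its limit gap is $\operatorname{LG}((x_n))=\liminf_{n\to\infty}|x_{n+1}-x_n|$, and the sequence has bounded gaps if $0<\operatorname{LG}((x_n))<\infty$. Let $\Gamma\subset\operatorname{PSL}_2(\mathbb{R})=\operatorname{SL}_2(\mathbb{R})/\{\pm1\}$ be a discrete subgroup of finite covolume, acting on the upper half plane by linear fractional transformations. An element $\gamma\in\Gamma$ is hyperbolic if a lift $\pm g\in\operatorname{SL}_2(\mathbb{R})$ has $|\operatorname{tr} g|>2$; then $g$ has eigenvalues $\pm\lambda^{\pm1}$ with $\lambda>1$, and one sets $N(\gamma)=\lambda$ (this is $e^{l(c)}$ for the corresponding closed geodesic $c$ on $\Gamma\backslash\mathbb{H}$, with lengths normalized so that this holds). A hyperbolic $\gamma\in\Gamma$ is primitive if it is not of the form $\delta^k$ with $\delta\in\Gamma$ and $k\ge 2$; primitive hyperbolic conjugacy classes correspond to primitive closed geodesics. Let $N(\Gamma)$ be the sequence of the distinct values $N(\gamma)$, $\gamma$ ranging over primitive hyperbolic elements of $\Gamma$, in increasing order (multiplicities ignored), and $\operatorname{LG}(\Gamma)=\operatorname{LG}(N(\Gamma))$.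 $\Gamma$ is called a bounded gaps group if $0<\operatorname{LG}(\Gamma)<\infty$. For $N\ge2$, $\Gamma(N)$ denotes the kernel of the reduction homomorphism $\operatorname{PSL}_2(\mathbb{Z})\to\operatorname{PSL}_2(\mathbb{Z}/N\mathbb{Z})$. *)

(* Defs.v *)
From HB Require Import structures.
From mathcomp Require Import all_boot all_order all_algebra generic_quotient.
From mathcomp Require Import all_classical all_reals all_analysis.
Set Implicit Arguments.
Unset Strict Implicit.
Unset Printing Implicit Defensive.
Import Order.TTheory GRing.Theory Num.Theory.
Import numFieldNormedType.Exports.
Local Open Scope classical_set_scope.
Local Open Scope ring_scope.
Local Open Scope quotient_scope.

Record SL2 (A : comNzRingType) :=
  MkSL2 { SL2_val :> 'M[A]_2; _ : \det SL2_val == 1 }.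

HB.instance Definition _ (A : comNzRingType) := [isSub for @SL2_val A].
HB.instance Definition _ (A : comNzRingType) := [Choice of SL2 A by <:].

Section SL2Group.
Variable A : comNzRingType.
Implicit Types g h k : SL2 A.

Lemma SL2_det g : \det (SL2_val g) = 1.
Proof. by case: g => g /= /eqP. Qed.

Fact SL2_one_subproof : \det (1%:M : 'M[A]_2) == 1.
Proof. by rewrite det1. Qed.
Definition SL2_one : SL2 A := MkSL2 SL2_one_subproof.

Fact SL2_mul_subproof g h : \det (SL2_val g *m SL2_val h) == 1.
Proof. by rewrite det_mulmx !SL2_det mulr1. Qed.
Definition SL2_mul g h : SL2 A := MkSL2 (SL2_mul_subproof g h).

Fact SL2_inv_subproof g : \det (\adj (SL2_val g)) == 1.
Proof.
have := congr1 determinant (mul_mx_adj (SL2_val g)).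
by rewrite det_mulmx det_scalar !SL2_det expr1n mul1r => ->.
Qed.
Definition SL2_inv g : SL2 A := MkSL2 (SL2_inv_subproof g).

Fact SL2_opp_subproof g : \det (- SL2_val g) == 1.
Proof. by rewrite -scaleN1r detZ SL2_det mulr1 sqrrN expr1n. Qed.
Definition SL2_opp g : SL2 A := MkSL2 (SL2_opp_subproof g).

Fact SL2_mulA : associative SL2_mul.
Proof. by move=> g h k; apply: val_inj; rewrite /= mulmxA. Qed.
Fact SL2_mul1 : left_id SL2_one SL2_mul.
Proof. by move=> g; apply: val_inj; rewrite /= mul1mx. Qed.
Fact SL2_mulr1 : right_id SL2_one SL2_mul.
Proof. by move=> g; apply: val_inj; rewrite /= mulmx1. Qed.
Fact SL2_mulV : left_inverse SL2_one SL2_inv SL2_mul.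
Proof. by move=> g; apply: val_inj; rewrite /= mul_adj_mx SL2_det. Qed.
Fact SL2_mulrV : right_inverse SL2_one SL2_inv SL2_mul.
Proof. by move=> g; apply: val_inj; rewrite /= mul_mx_adj SL2_det. Qed.

HB.instance Definition _ := isGroup.Build (SL2 A)
  SL2_mulA SL2_mul1 SL2_mulr1 SL2_mulV SL2_mulrV.

Lemma SL2_oppK : involutive SL2_opp.
Proof. by move=> g; apply: val_inj; rewrite /= opprK. Qed.
Lemma SL2_mulNg g h : (SL2_opp g * h)%g = SL2_opp (g * h)%g.
Proof. by apply: val_inj; rewrite /= mulNmx. Qed.
Lemma SL2_mulgN g h : (g * SL2_opp h)%g = SL2_opp (g * h)%g.
Proof. by apply: val_inj; rewrite /= mulmxN. Qed.
Lemma SL2_invN g : ((SL2_opp g)^-1)%g = SL2_opp (g^-1)%g.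
Proof.
apply: (mulgI (SL2_opp g)).
by rewrite mulgV SL2_mulNg SL2_mulgN SL2_oppK mulgV.
Qed.

Definition pm_eq : rel (SL2 A) := fun g h => (g == h) || (g == SL2_opp h).

Fact pm_eq_refl : reflexive pm_eq.
Proof. by move=> g; rewrite /pm_eq eqxx. Qed.
Fact pm_eq_sym : symmetric pm_eq.
Proof.
move=> g h; rewrite /pm_eq [h == g]eq_sym; congr (_ || _).
by rewrite -(inj_eq (inv_inj SL2_oppK)) SL2_oppK eq_sym.
Qed.
Fact pm_eq_trans : transitive pm_eq.
Proof.
move=> h g k /orP[] /eqP -> /orP[] /eqP ->;
  by rewrite /pm_eq ?SL2_oppK ?eqxx ?orbT.
Qed.

Canonical pm_eq_equiv := EquivRel pm_eq pm_eq_refl pm_eq_sym pm_eq_trans.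

End SL2Group.

(* SL_2(A) modulo the scalars +1 and -1, for every commutative ring A, in
   particular also for A = Z/NZ, where SL_2(A) can have a larger centre. *)
Definition PSL2 (A : comNzRingType) := {eq_quot (@pm_eq A)}.

HB.instance Definition _ (A : comNzRingType) := Choice.on (PSL2 A).
HB.instance Definition _ (A : comNzRingType) := EqQuotient.on (PSL2 A).

Definition PSL2_pi (A : comNzRingType) (g : SL2 A) : PSL2 A := \pi_(PSL2 A) g.

Section PSL2Group.
Variable A : comNzRingType.
Implicit Types g h : SL2 A.
Implicit Types x y z : PSL2 A.

Lemma PSL2_piP g h : PSL2_pi g = PSL2_pi h <-> (g = h \/ g = SL2_opp h).
Proof.
split=> [/eqP|gh].
  by rewrite /PSL2_pi eqmodE => /orP[] /eqP; [left | right].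
by apply/eqP; rewrite /PSL2_pi eqmodE; apply/orP; case: gh => /eqP; auto.
Qed.

Lemma PSL2_pi_opp g : PSL2_pi (SL2_opp g) = PSL2_pi g.
Proof. by apply/PSL2_piP; right. Qed.

Lemma PSL2_reprK x : PSL2_pi (repr x) = x.
Proof. exact: reprK. Qed.

Lemma PSL2_repr_pi g : repr (PSL2_pi g) = g \/ repr (PSL2_pi g) = SL2_opp g.
Proof. by apply/PSL2_piP; rewrite PSL2_reprK. Qed.

Definition PSL2_one : PSL2 A := PSL2_pi 1%g.
Definition PSL2_mul x y : PSL2 A := PSL2_pi (repr x * repr y)%g.
Definition PSL2_inv x : PSL2 A := PSL2_pi ((repr x)^-1)%g.

Fact PSL2_pi_mul g h : PSL2_mul (PSL2_pi g) (PSL2_pi h) = PSL2_pi (g * h)%g.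
Proof.
rewrite /PSL2_mul; case: (PSL2_repr_pi g) => ->;
  case: (PSL2_repr_pi h) => ->;
  by rewrite ?SL2_mulNg ?SL2_mulgN ?PSL2_pi_opp.
Qed.

Fact PSL2_pi_inv g : PSL2_inv (PSL2_pi g) = PSL2_pi (g^-1)%g.
Proof.
by rewrite /PSL2_inv; case: (PSL2_repr_pi g) => ->;
  rewrite ?SL2_invN ?PSL2_pi_opp.
Qed.

Fact PSL2_mulA : associative PSL2_mul.
Proof.
move=> x y z; rewrite -(PSL2_reprK x) -(PSL2_reprK y) -(PSL2_reprK z).
by rewrite !PSL2_pi_mul mulgA.
Qed.
Fact PSL2_mul1 : left_id PSL2_one PSL2_mul.
Proof. by move=> x; rewrite -(PSL2_reprK x) PSL2_pi_mul mul1g. Qed.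
Fact PSL2_mulr1 : right_id PSL2_one PSL2_mul.
Proof. by move=> x; rewrite -(PSL2_reprK x) PSL2_pi_mul mulg1. Qed.
Fact PSL2_mulV : left_inverse PSL2_one PSL2_inv PSL2_mul.
Proof.
by move=> x; rewrite -(PSL2_reprK x) PSL2_pi_inv PSL2_pi_mul mulVg.
Qed.
Fact PSL2_mulrV : right_inverse PSL2_one PSL2_inv PSL2_mul.
Proof.
by move=> x; rewrite -(PSL2_reprK x) PSL2_pi_inv PSL2_pi_mul mulgV.
Qed.

HB.instance Definition _ := isGroup.Build (PSL2 A)
  PSL2_mulA PSL2_mul1 PSL2_mulr1 PSL2_mulV PSL2_mulrV.

Lemma PSL2_piM g h : PSL2_pi (g * h)%g = (PSL2_pi g * PSL2_pi h)%g.
Proof. by rewrite -PSL2_pi_mul. Qed.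

End PSL2Group.

Section PSL2Map.
Variables (A B : comNzRingType) (f : {rmorphism A -> B}).

Fact SL2_map_subproof (g : SL2 A) : \det (map_mx f (SL2_val g)) == 1.
Proof. by rewrite det_map_mx SL2_det rmorph1. Qed.
Definition SL2_map (g : SL2 A) : SL2 B := MkSL2 (SL2_map_subproof g).

Definition PSL2_map (x : PSL2 A) : PSL2 B := PSL2_pi (SL2_map (repr x)).

Lemma SL2_map_opp g : SL2_map (SL2_opp g) = SL2_opp (SL2_map g).
Proof. by apply: val_inj; rewrite /= map_mxN. Qed.

Lemma SL2_mapM g h : SL2_map (g * h)%g = (SL2_map g * SL2_map h)%g.
Proof. by apply: val_inj; rewrite /= map_mxM. Qed.

Lemma PSL2_map_pi g : PSL2_map (PSL2_pi g) = PSL2_pi (SL2_map g).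
Proof.
by rewrite /PSL2_map; case: (PSL2_repr_pi g) => ->;
  rewrite ?SL2_map_opp ?PSL2_pi_opp.
Qed.

Fact PSL2_map_is_multiplicative : {morph PSL2_map : x y / (x * y)%g}.
Proof.
move=> x y; rewrite -(PSL2_reprK x) -(PSL2_reprK y) -PSL2_piM !PSL2_map_pi.
by rewrite SL2_mapM PSL2_piM.
Qed.
HB.instance Definition _ :=
  isMultiplicative.Build (PSL2 A) (PSL2 B) PSL2_map PSL2_map_is_multiplicative.

End PSL2Map.

Section LimitGap.
Variable R : realType.

Definition LG_seq (x : nat -> R) : \bar R :=
  limn_einf (fun n => (`|x n.+1 - x n|)%:E).

(* Such a sequence is unique if it exists.  If S has no increasing enumeration,
   the value is the constant sequence 0, whose limit gap is 0. *)
Definition increasing_enumeration (S : set R) : nat -> R :=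
  xget (fun=> 0) [set x : nat -> R | increasing_seq x /\ range x = S].

Implicit Types (G : set (PSL2 R)) (x : PSL2 R).

Definition hyperbolic x : Prop :=
  exists2 g : SL2 R, PSL2_pi g = x & 2 < `|\tr (SL2_val g)|.

(* Since g and - g are lifts of the same element, the lift can be chosen with
   positive eigenvalues; the value is 0 if x is not hyperbolic. *)
Definition hyp_norm x : R :=
  xget 0 [set l : R | 1 < l /\ exists g : SL2 R,
    [/\ PSL2_pi g = x, eigenvalue (SL2_val g) l & eigenvalue (SL2_val g) l^-1]].

Definition primitive_hyperbolic G x : Prop :=
  [/\ G x, hyperbolic x &
      ~ exists d k, [/\ G d, (2 <= k)%N & x = (d ^+ k)%g]].

Definition norm_seq G : nat -> R :=
  increasing_enumeration [set hyp_norm x | x in primitive_hyperbolic G].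

Definition LG G : \bar R := LG_seq (norm_seq G).

Definition bounded_gaps_group G : Prop := (0 < LG G < +oo)%E.

(* PSL_2(Z) and its subgroups are seen inside PSL_2(R). *)
Definition PSL2Z_to_R : PSL2 int -> PSL2 R :=
  PSL2_map (intmul 1 : {rmorphism int -> R}).

Definition PSL2Z : set (PSL2 R) := range PSL2Z_to_R.

(* For 1 < N, 'Z_N is the ring Z/NZ; for N = 0 and N = 1 it is Z/2Z. *)
Definition PSL2_reduction (N : nat) : PSL2 int -> PSL2 'Z_N :=
  PSL2_map (intmul 1 : {rmorphism int -> 'Z_N}).

Definition principal_congruence_subgroup (N : nat) : set (PSL2 R) :=
  PSL2Z_to_R @` [set x | PSL2_reduction N x = 1%g].

End LimitGap.

Arguments PSL2Z : clear implicits.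
Arguments principal_congruence_subgroup : clear implicits.

(* Main.v *)
(* A hyperbolic element of trace [t] has norm [l > 1] with [l + l^-1 = `|t|], so
   the norms of a subgroup of PSL_2(Z) correspond increasingly to a set of
   integers, and two norms with traces [t < t'] differ by
   [t' - t + l^-1 - l'^-1], which lies between [1] and [t' - t + l^-1].
   For every [m > 0] the matrix [[1 + N^2 m, N], [N m, 1]] is primitive in
   Gamma(N): if it were [+- d ^ k] with [d] in Gamma(N), its upper right entry
   [N] would be [+- U_k] times a multiple of [N], where
   [d ^ k = U_k d - U_(k-1)].  This forces [U_k = +- 1]; then [d] has the same
   absolute trace as its power, hence is hyperbolic, and [`|U_k| >= k > 1].
   So all integers [2 + N^2 m] are traces, the gaps are eventually at most
   [N^2 + e], and [1 <= LG <= N^2].  The modular group is the case [N = 1]. *)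
Require Import Defs.
From mathcomp Require Import all_boot all_order all_algebra.
From mathcomp Require Import all_classical all_reals all_analysis.
From mathcomp Require Import zify ring lra.

Set Implicit Arguments.
Unset Strict Implicit.
Unset Printing Implicit Defensive.
Import Order.TTheory GRing.Theory Num.Theory.
Local Open Scope classical_set_scope.
Local Open Scope ring_scope.

(** * Two-by-two matrices and powers in [SL2 int] *)

Lemma mxtrace2 (A : comNzRingType) (M : 'M[A]_2) : \tr M = M 0 0 + M 1 1.
Proof.
rewrite /mxtrace !big_ord_recl big_ord0 addr0.
by congr (_ + M _ _); apply: val_inj.
Qed.

Lemma det2 (A : comNzRingType) (M : 'M[A]_2) :
  \det M = M 0 0 * M 1 1 - M 0 1 * M 1 0.
Proof.
rewrite (expand_det_row _ 0) !big_ord_recl big_ord0 addr0 /cofactor !det_mx11.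
rewrite !mxE /= expr0 expr1 mul1r mulN1r mulrN.
by congr (M _ _ * M _ _ - M _ _ * M _ _); apply: val_inj.
Qed.

Lemma eq_mx2 (A : comNzRingType) (M M' : 'M[A]_2) :
  M 0 0 = M' 0 0 -> M 0 1 = M' 0 1 -> M 1 0 = M' 1 0 -> M 1 1 = M' 1 1 ->
  M = M'.
Proof.
move=> e00 e01 e10 e11; apply/matrixP => i j.
have ord2 (k : 'I_2) : k = 0 \/ k = 1.
  by case: k => -[|[|//]] lt_k2; [left|right]; apply: val_inj.
by case: (ord2 i) => ->; case: (ord2 j) => ->.
Qed.

Lemma mulmx2 (A : comNzRingType) (M M' : 'M[A]_2) i j :
  (M *m M') i j = M i 0 * M' 0 j + M i 1 * M' 1 j.
Proof.
rewrite mxE !big_ord_recl big_ord0 addr0.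
by congr (_ + M _ _ * M' _ _); apply: val_inj.
Qed.

(* [u] and [v] are the values at [n] and [n.+1] of the Lucas sequence
   [U_0 = 0, U_1 = 1, U_(m+2) = \tr g * U_(m+1) - U_m]. *)
Lemma SL2_expgS_lucas (g : SL2 int) (n : nat) : exists u v : int,
  [/\ SL2_val (g ^+ n.+1)%g = v *: SL2_val g - u%:M,
      u ^+ 2 - \tr (SL2_val g) * u * v + v ^+ 2 = 1
    & 2 <= `|\tr (SL2_val g)| -> `|u| < `|v| /\ n%:Z < `|v|].
Proof.
elim: n => [|n [u [v [gE uvE uv_lt]]]].
  exists 0, 1; rewrite expg1 scale1r; split=> //.
  - by apply: eq_mx2; rewrite !mxE ?subr0 ?mul0rn ?subr0.
  - by rewrite expr0n /= mulr0 mul0r subr0 add0r expr1n.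
have := SL2_det g; rewrite det2 => /eqP; rewrite subr_eq => /eqP detg.
exists v, (\tr (SL2_val g) * v - u); split.
(* This is Cayley-Hamilton, [g ^+ 2 = \tr g * g - 1]; entrywise it reduces to the determinant
   relation multiplied by [v]. *)
- rewrite expgS [SL2_val _]/= gE mxtrace2.
  apply: eq_mx2; rewrite mulmx2 !mxE /= ?mulr1n ?mulr0n ?subr0; move: detg;
    move: (SL2_val g 0 0 : int) (SL2_val g 0 1 : int) (SL2_val g 1 0 : int)
      (SL2_val g 1 1 : int) => a b c d /(congr1 ( *%R v)); lra.
- rewrite -[RHS]uvE; ring.
- move=> s_ge2; have [] := uv_lt s_ge2.
  set s := \tr _ in s_ge2 *; move=> ltuv ltnv.
  (* Hence [|s * v - u| >= 2 * |v| - |u| > |v| >= n + 1]. *)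
  have : `|s * v| <= `|s * v - u| + `|u|.
    by rewrite -{1}(subrK u (s * v)) ler_normD.
  rewrite normrM; nia.
Qed.

(** Comparing upper right entries in [g = e (v d - u)] forces [v = 1] or [v = -1]. The quadratic
    invariant of [u] and [v] then equates the absolute traces of [g] and [d], so [d] is hyperbolic
    and [|v|] exceeds 1. *)
Lemma SL2_nonpower (g d : SL2 int) (k : nat) :
  (2 <= k)%N -> 2 < `|\tr (SL2_val g)| -> SL2_val g 0 1 != 0 ->
  (SL2_val g 0%R 1%R %| SL2_val d 0%R 1%R)%Z ->
  ~ (g = (d ^+ k)%g \/ g = SL2_opp (d ^+ k)%g).
Proof.
case: k => // n; rewrite ltnS => n_gt0 trg_gt2 g01_neq0 /dvdzP[q d01E] gE.
have [u [v [dE uvE uv_lt]]] := SL2_expgS_lucas d n.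
have [e [e1 gdE]] : exists e : int, e ^+ 2 = 1 /\
    SL2_val g = e *: (v *: SL2_val d - u%:M).
  case: gE => ->; rewrite -dE; [exists 1|exists (-1)].
    by rewrite scale1r.
  by rewrite scaleN1r.
have : SL2_val g 0 1 = e * (v * SL2_val d 0 1).
  by rewrite gdE !mxE /= subr0.
have : `|\tr (SL2_val g)| ^+ 2 = (v * \tr (SL2_val d) - 2 * u) ^+ 2.
  have -> : \tr (SL2_val g) = e * (v * \tr (SL2_val d) - 2 * u).
    by rewrite gdE !mxtrace2 !mxE /=; ring.
  by rewrite real_normK ?num_real// exprMn e1 mul1r.
move: uvE uv_lt trg_gt2 g01_neq0 d01E.
set s := \tr (SL2_val d); set t := `|\tr (SL2_val g)|; set b := SL2_val g 0 1.
move=> uvE uv_lt t_gt2 b_neq0 -> t2E bE.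
have v2 : v ^+ 2 = 1.
  have : e * v * q = 1 by apply: (mulIf b_neq0); rewrite mul1r [RHS]bE; ring.
  rewrite mulrAC mulrC => vq1.
  have : v \is a GRing.unit by apply/unitrPr; exists (e * q).
  by move=> /orP[] /eqP ->.
have s2 : `|s| ^+ 2 = t ^+ 2.
  rewrite t2E real_normK ?num_real//.
  (* The square is rewritten so that the invariant appears; with [v ^+ 2 = 1] the constants cancel
     and [s ^+ 2] remains. *)
  have -> : (v * s - 2 * u) ^+ 2 =
    v ^+ 2 * s ^+ 2 + 4 * (u ^+ 2 - s * u * v + v ^+ 2) - 4 * v ^+ 2 by ring.
  by rewrite uvE v2 mul1r addrK.
have st : `|s| = t by apply/eqP; rewrite -(@eqrXn2 _ 2) ?s2// normr_ge0.
have [|_] := uv_lt; first by rewrite st ltW.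
by move/eqP: v2; rewrite sqrf_eq1 => /orP[] /eqP ->;
  rewrite ?normrN normr1 ltz_nat ltnNge n_gt0.
Qed.

(** * Compatibility of powers, quotients and change of ring *)

Lemma PSL2_pi_expg (A : comNzRingType) (g : SL2 A) (n : nat) :
  PSL2_pi (g ^+ n)%g = (PSL2_pi g ^+ n)%g.
Proof. by elim: n => // n IHn; rewrite !expgS PSL2_piM IHn. Qed.

Lemma SL2_map_expg (A B : comNzRingType) (f : {rmorphism A -> B}) (g : SL2 A)
    (n : nat) :
  SL2_map f (g ^+ n)%g = (SL2_map f g ^+ n)%g.
Proof.
elim: n => [|n IHn]; first by apply: val_inj; rewrite /= map_mx1.
by rewrite !expgS SL2_mapM IHn.
Qed.

Lemma SL2_map_inj (A B : comNzRingType) (f : {rmorphism A -> B}) :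
  injective f -> injective (SL2_map f).
Proof.
move=> f_inj g h /(congr1 (@SL2_val B))/matrixP gh; apply: val_inj.
by apply/matrixP => i j; apply: f_inj; have := gh i j; rewrite !mxE.
Qed.

Lemma PSL2_map_inj (A B : comNzRingType) (f : {rmorphism A -> B}) :
  injective f -> injective (PSL2_map f).
Proof.
move=> f_inj x y; rewrite -(PSL2_reprK x) -(PSL2_reprK y) !PSL2_map_pi.
move=> /PSL2_piP xy; apply/PSL2_piP.
case: xy => [/(SL2_map_inj f_inj) ->|]; first by left.
by rewrite -SL2_map_opp => /(SL2_map_inj f_inj) ->; right.
Qed.

Lemma PSL2_map_expg (A B : comNzRingType) (f : {rmorphism A -> B}) (x : PSL2 A)
    (n : nat) :
  PSL2_map f (x ^+ n)%g = (PSL2_map f x ^+ n)%g.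
Proof.
rewrite -(PSL2_reprK x) -PSL2_pi_expg !PSL2_map_pi SL2_map_expg.
by rewrite PSL2_pi_expg.
Qed.

(** * Norms and traces of hyperbolic elements *)

Lemma eigenvalue_SL2 (F : fieldType) (g : SL2 F) (l : F) :
  eigenvalue (SL2_val g) l = (l ^+ 2 - \tr (SL2_val g) * l + 1 == 0).
Proof.
rewrite eigenvalue_root_char rootE /char_poly -horner_evalE -det_map_mx det2.
rewrite !mxE /= !horner_evalE !hornerE mxtrace2 -(SL2_det g) det2.
by congr (_ == 0); ring.
Qed.

Section HypNorm.
Variable R : realType.
Implicit Types (l : R) (x : PSL2 R) (g : SL2 R).

Lemma norm_tr_pi g h : PSL2_pi g = PSL2_pi h ->
  `|\tr (SL2_val g)| = `|\tr (SL2_val h)|.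
Proof.
by case/PSL2_piP => ->//; rewrite /= linearN /= normrN.
Qed.

(** Whatever value [xget] picks has the right trace, and the default 0 is ruled out by the larger
    root [(t + r) / 2] of [X^2 - t X + 1]. *)
Lemma hyp_norm_spec g : 2 < `|\tr (SL2_val g)| ->
  1 < hyp_norm (PSL2_pi g) /\
  hyp_norm (PSL2_pi g) + (hyp_norm (PSL2_pi g))^-1 = `|\tr (SL2_val g)|.
Proof.
move=> g_hyp.
have eigP h l : l != 0 -> eigenvalue (SL2_val h) l ->
    \tr (SL2_val h) = l + l^-1.
  rewrite eigenvalue_SL2 => l_neq0 /eqP lE; apply: (mulIf l_neq0).
  by rewrite mulrDl mulVf//; lra.
rewrite /hyp_norm.
case: xgetP => [l _ [l_gt1 [h [/norm_tr_pi hg /eigP hl _]]]|].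
  have l_gt0 := lt_trans ltr01 l_gt1.
  by split=> //; rewrite -hg hl ?gt_eqF// gtr0_norm// addr_gt0 ?invr_gt0.
set t := `|_| in g_hyp *.
pose r := Num.sqrt (t ^+ 2 - 4).
have r2 : r ^+ 2 = t ^+ 2 - 4 by rewrite sqr_sqrtr//; nra.
have r_ge0 : 0 <= r := sqrtr_ge0 _.
pose l := (t + r) / 2.
have l_gt1 : 1 < l by rewrite /l; lra.
have lE : l^-1 = (t - r) / 2.
  apply: (mulfI (_ : l != 0)); first by rewrite gt_eqF// (lt_trans ltr01).
  by rewrite divff ?gt_eqF ?(lt_trans ltr01)// /l; lra.
(* Of the two lifts, the one with positive trace has positive eigenvalues. *)
have [h [hg trh]] : exists h, PSL2_pi h = PSL2_pi g /\ \tr (SL2_val h) = t.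
  rewrite /t; have [tr_ge0|tr_lt0] := lerP 0 (\tr (SL2_val g)).
    by exists g; rewrite ger0_norm.
  by exists (SL2_opp g); rewrite PSL2_pi_opp /= linearN ltr0_norm.
move=> /(_ l) []; split=> //; exists h; split=> //.
  by rewrite eigenvalue_SL2 trh /l; apply/eqP; lra.
by rewrite lE eigenvalue_SL2 trh; apply/eqP; lra.
Qed.

End HypNorm.

(** * Increasing enumerations and limit gaps *)

Lemma nat_set_enumeration (T : set nat) :
  (forall n : nat, exists2 m, (n <= m)%N & T m) ->
  exists2 e : nat -> nat, (forall n, (e n < e n.+1)%N) & range e = T.
Proof.
move=> T_inf.
have T_infb n : exists m, (n <= m)%N && `[< T m >].
  by have [m nm Tm] := T_inf n; exists m; rewrite nm; apply/asboolP.
pose next n := ex_minn (T_infb n).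
have nextT n : T (next n).
  by rewrite /next; case: ex_minnP => m /andP[_ /asboolP].
have next_ge n : (n <= next n)%N.
  by rewrite /next; case: ex_minnP => m /andP[].
have next_min n m : (n <= m)%N -> T m -> (next n <= m)%N.
  move=> nm Tm; rewrite /next; case: ex_minnP => k _; apply.
  by rewrite nm; apply/asboolP.
(* Each term is the least element of [T] above the preceding one. *)
pose e n := iter n (next \o succn) (next 0%N).
exists e => [n|]; first exact: next_ge.
apply/seteqP; split=> [_ [n _ <-]|m Tm]; first by case: n => [|n]; exact: nextT.
have e_ge n : (n <= e n)%N.
  by elim: n => // n IHn; rewrite (leq_ltn_trans IHn)//; exact: next_ge.
suff [//|[n le_mn e_lt]] : range e m \/ exists2 n, (m <= n)%N & (e n < m)%N.
  by have := leq_ltn_trans (leq_trans le_mn (e_ge n)) e_lt; rewrite ltnn.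
(* An element [m] never reached would stay above every [e n], contradicting [m <= e m]. *)
suff : forall n, range e m \/ (e n < m)%N.
  by move=> /(_ m) []; [left|right; exists m].
elim=> [|n [|lt_nm]]; [|by left|].
- have := next_min 0%N m isT Tm.
  rewrite leq_eqVlt => /orP[/eqP <-|]; last by right.
  by left; exists 0%N.
- have := next_min (e n).+1 m lt_nm Tm.
  rewrite leq_eqVlt => /orP[/eqP <-|]; last by right.
  by left; exists n.+1.
Qed.

Section LimitGap.
Variable R : realType.
Implicit Types (l : R) (S : set R).

(** The two sums differ by [(l' - l) * (1 - (l * l')^-1)], whose second factor is positive. *)
Lemma ler_add_inv l l' : 1 < l -> 1 < l' ->
  (l + l^-1 <= l' + l'^-1) = (l <= l').
Proof.
move=> l_gt1 l'_gt1.
have l_gt0 := lt_trans ltr01 l_gt1; have l'_gt0 := lt_trans ltr01 l'_gt1.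
have -> : (l <= l') = (0 <= (l' - l) * (1 - (l * l')^-1)).
  rewrite pmulr_lge0 ?subr_ge0// subr_gt0 invf_lt1 ?mulr_gt0//.
  by rewrite mulr_egt1// ltW.
rewrite -subr_ge0; congr (0 <= _); field.
by rewrite !gt_eqF.
Qed.

Lemma increasing_enumerationP S :
  (exists x : nat -> R, increasing_seq x /\ range x = S) ->
  increasing_seq (increasing_enumeration S) /\
  range (increasing_enumeration S) = S.
Proof. exact: xgetPex. Qed.

Lemma limn_einf_ge (u : nat -> \bar R) (a : \bar R) :
  (forall n, a <= u n)%E -> (a <= limn_einf u)%E.
Proof.
move=> ge_a; rewrite limn_einf_lim (cvg_lim _ (@cvg_einfs_sup _ u))//.
apply: le_trans (ereal_sup_ubound _); last by exists 0%N.
by apply: le_ereal_inf_tmp => _ [k _ <-].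
Qed.

Lemma limn_einf_le (u : nat -> \bar R) (b : \bar R) :
  (forall n : nat, exists2 k, (n <= k)%N & u k <= b)%E -> (limn_einf u <= b)%E.
Proof.
move=> le_b; rewrite limn_einf_lim (cvg_lim _ (@cvg_einfs_sup _ u))//.
apply: ge_ereal_sup => _ [n _ <-]; have [k nk ukb] := le_b n.
by apply: le_trans ukb; apply: ereal_inf_lbound; exists k.
Qed.

(** Meant for the norms of a subgroup, with [l + l^-1] as trace. Since this map is increasing,
    enumerating the integer traces enumerates [S]. *)
Lemma LG_seq_trace_set S (d : nat) : (0 < d)%N ->
  (forall l, S l -> 1 < l /\ exists t : nat, l + l^-1 = t%:R) ->
  (forall m : nat, exists2 l, S l & l + l^-1 = (2 + d * m.+1)%:R) ->
  (1 <= LG_seq (increasing_enumeration S) <= d%:R%:E)%E.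
Proof.
move=> d_gt0 Str SAP.
have [|x_incr x_range] := @increasing_enumerationP S.
  pose T := [set t : nat | exists2 l, S l & l + l^-1 = t%:R].
  have [n|e e_incr e_range] := @nat_set_enumeration T.
    by exists (2 + d * n.+1)%N; [nia|exact: SAP].
  have /choice[x xP] : forall n, exists l, S l /\ l + l^-1 = (e n)%:R.
    move=> n; have : T (e n) by rewrite -e_range; exists n.
    by case=> l Sl lE; exists l.
  exists x; split.
    move=> m n; rewrite -ler_add_inv; last 2 first.
    - by have [/Str[]] := xP m.
    - by have [/Str[]] := xP n.
    have [_ ->] := xP m; have [_ ->] := xP n.
    rewrite ler_nat; apply: leq_mono; apply: homo_ltn => //; exact: ltn_trans.
  apply/seteqP; split=> [_ [n _ <-]|l Sl]; first by have [] := xP n.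
  have [l_gt1 [t tE]] := Str _ Sl.
  have : range e t by rewrite e_range; exists l.
  case=> n _ etE; exists n => //; have [Sx xE] := xP n.
  have [x_gt1 _] := Str _ Sx.
  apply/le_anti; rewrite -(ler_add_inv x_gt1 l_gt1) -(ler_add_inv l_gt1 x_gt1).
  by rewrite xE tE etE lexx.
set x := increasing_enumeration S in x_incr x_range *.
have Sx n : S (x n) by rewrite -x_range; exists n.
have x_gt1 n : 1 < x n by have [] := Str _ (Sx n).
have ltx m n : (x m < x n) = (m < n)%N by rewrite ltNge x_incr ltnNge.
have x_lt n : x n < x n.+1 by rewrite ltx.
have inv_lt n : (x n.+1)^-1 < (x n)^-1.
  by rewrite ltf_pV2 ?posrE// (lt_trans ltr01).
have gap_ge1 n : 1 <= x n.+1 - x n.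
  have [_ [t tE]] := Str _ (Sx n); have [_ [t' t'E]] := Str _ (Sx n.+1).
  have : (t < t')%N.
    by rewrite ltnNge -(ler_nat R) -tE -t'E ler_add_inv// -ltNge.
  rewrite -(ler_nat R) -natr1 => ?; have := inv_lt n; lra.
(* This growth makes the error [(x n)^-1] in the gap bound tend to 0. *)
have x_ge n : n.+1%:R <= x n.
  elim: n => [|n IHn]; first exact: ltW.
  by have := gap_ge1 n; rewrite -natr1; lra.
have gap_le n : x n.+1 - x n <= d%:R + n.+1%:R^-1.
  have [_ [t tE]] := Str _ (Sx n).
  (* This index gives the first term of the progression above [t]; it is at most [t + d], and its
     norm bounds [x n.+1]. *)
  have [l Sl lE] := SAP ((t - 2) %/ d)%N.
  (* Makes the truncated subtraction [t - 2] exact. *)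
  have t_gt2 : (2 < t)%N.
    rewrite -(ltr_nat R) -tE -subr_gt0.
    have -> : x n + (x n)^-1 - 2 = (x n - 1) ^+ 2 / x n.
      by field; rewrite gt_eqF// (lt_trans ltr01).
    by rewrite divr_gt0 ?exprn_gt0 ?subr_gt0// (lt_trans ltr01).
  have [l_gt1 _] := Str _ Sl.
  have ltxl : x n < l.
    rewrite ltNge -ler_add_inv// lE tE ler_nat -ltnNge.
    by have := ltn_ceil (t - 2) d_gt0; lia.
  have : range x l by rewrite x_range.
  case=> k _ xk; move: ltxl; rewrite -xk ltx => lt_nk.
  have le_xl : x n.+1 <= l by rewrite -xk x_incr.
  have : (2 + d * ((t - 2) %/ d).+1 <= t + d)%N.
    by have := leq_trunc_div (t - 2) d; lia.
  rewrite -(ler_nat R) -lE natrD -tE => le_td.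
  have : (x n)^-1 <= n.+1%:R^-1.
    by rewrite lef_pV2 ?posrE ?ltr0n// (lt_trans ltr01).
  have : 0 < l^-1 by rewrite invr_gt0 (lt_trans ltr01).
  move: n.+1%:R^-1 => r; lra.
have gapE n : `|x n.+1 - x n| = x n.+1 - x n.
  by rewrite gtr0_norm// subr_gt0.
apply/andP; split; first by apply: limn_einf_ge => n; rewrite lee_fin gapE.
apply/lee_addgt0Pr => e e_gt0; apply: limn_einf_le => n.
have [N _ NP] := near_infty_natSinv_lt (PosNum e_gt0).
exists (maxn n N); first exact: leq_maxl.
rewrite lee_fin gapE (le_trans (gap_le _))// lerD2l ltW//.
by apply: NP; exact: leq_maxr.
Qed.

End LimitGap.

(** * Shears and congruence subgroups *)

Fact shear_subproof (N m : nat) : \det (\matrix_(i < 2, j < 2)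
  (if i == 0 then if j == 0 then 1 + N%:Z ^+ 2 * m%:Z else N%:Z
   else if j == 0 then N%:Z * m%:Z else 1) : 'M[int]_2) == 1.
Proof. by apply/eqP; rewrite det2 !mxE /=; ring. Qed.

(* The upper right entry [N] divides that of every element of Gamma(N), which
   makes the matrix primitive there. *)
Definition shear (N m : nat) : SL2 int := MkSL2 (shear_subproof N m).

Lemma tr_SL2_map (A B : comNzRingType) (f : {rmorphism A -> B}) (g : SL2 A) :
  \tr (SL2_val (SL2_map f g)) = f (\tr (SL2_val g)).
Proof. by rewrite /= !mxtrace2 !mxE rmorphD. Qed.

(** Treats the modular group, as [N = 1], and Gamma(N) together: the divisibility hypothesis rules
    out proper roots of shears in [H]. *)
Lemma LG_bounds (R : realType) (N : nat) (H : set (PSL2 int)) : (0 < N)%N ->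
  (forall g : SL2 int, H (PSL2_pi g) -> (N %| SL2_val g 0%R 1%R)%Z) ->
  (forall m, H (PSL2_pi (shear N m))) ->
  (1 <= LG (@PSL2Z_to_R R @` H) <= (N ^ 2)%:R%:E)%E.
Proof.
move=> N_gt0 H_dvd H_shear.
pose f : {rmorphism int -> R} := intmul 1.
have piE g : @PSL2Z_to_R R (PSL2_pi g) = PSL2_pi (SL2_map f g).
  by rewrite /PSL2Z_to_R PSL2_map_pi.
have trE g : `|\tr (SL2_val (SL2_map f g))| = `|\tr (SL2_val g)|%N%:R.
  by rewrite tr_SL2_map -intr_norm natr_absz.
apply: LG_seq_trace_set => [|l|m]; first by rewrite expn_gt0 N_gt0.
- move=> [_ [[y Hy <-] [g0 + g0_hyp] _] <-].
  rewrite -(PSL2_reprK y) piE => /norm_tr_pi g0E.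
  have [|l_gt1 lE] := @hyp_norm_spec _ (SL2_map f (repr y)).
    by rewrite -g0E.
  by split=> //; exists `|\tr (SL2_val (repr y))|%N; rewrite lE trE.
(* The successor keeps the trace above 2, so this shear is hyperbolic. *)
- pose g := shear N m.+1.
  have trg : \tr (SL2_val g) = (2 + N ^ 2 * m.+1)%N.
    by rewrite mxtrace2 !mxE /=; nia.
  have trg_gt2 : 2 < `|\tr (SL2_val g)| by rewrite trg; nia.
  have g_hyp : 2 < `|\tr (SL2_val (SL2_map f g))|.
    by rewrite tr_SL2_map -intr_norm (ltr_int R 2).
  have [_ gE] := hyp_norm_spec g_hyp.
  exists (hyp_norm (PSL2_pi (SL2_map f g))); last by rewrite gE trE trg.
  exists (PSL2_pi (SL2_map f g)) => //; split.
  - by exists (PSL2_pi g); [exact: H_shear|exact: piE].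
  - by exists (SL2_map f g).
  - move=> [_ [k [[y Hy <-] k_ge2]]].
    (* By injectivity the equation descends to [PSL2 int], then to lifts up to sign. *)
    rewrite -piE -PSL2_map_expg => /(PSL2_map_inj (@intr_inj R)).
    rewrite -(PSL2_reprK y) -PSL2_pi_expg => /PSL2_piP.
    apply: SL2_nonpower => //; rewrite mxE /=; first by case: (N) N_gt0.
    by apply: H_dvd; rewrite PSL2_reprK.
Qed.

Lemma intr_Zp_eq0 (N : nat) (a : int) : (1 < N)%N ->
  (a%:~R == 0 :> 'Z_N) = (N %| a)%Z.
Proof.
move=> N_gt1; rewrite dvdzE absz_nat.
have -> : (a%:~R == 0 :> 'Z_N) = (`|a|%N%:R == 0 :> 'Z_N).
  by case: a => n //; rewrite NegzE mulrNz oppr_eq0.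
by rewrite -val_eqE /= val_Zp_nat.
Qed.

Theorem theorem2p1 (R : realType) :
  (LG (PSL2Z R) = 1%E /\ bounded_gaps_group (PSL2Z R)) /\
  (forall N : nat, (2 <= N)%N ->
     bounded_gaps_group (principal_congruence_subgroup R N)).
Proof.
split.
  (* For [N = 1] the two bounds coincide. *)
  have /andP[ge1 le1] : (1 <= LG (PSL2Z R) <= (1 ^ 2)%:R%:E)%E.
    by apply: LG_bounds => // g _; rewrite dvd1z.
  have LG1 : LG (PSL2Z R) = 1%E by apply/le_anti; rewrite le1 ge1.
  by rewrite /bounded_gaps_group LG1 lte01 ltry.
move=> N N_gt1.
have /andP[ge1 leN] : (1 <= LG (principal_congruence_subgroup R N)
    <= (N ^ 2)%:R%:E)%E.
  apply: LG_bounds => [|g|m]; first exact: ltnW.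
    (* A lift reduces to the identity or its opposite; both have upper right entry 0. *)
    rewrite /= /PSL2_reduction PSL2_map_pi => /PSL2_piP gE.
    rewrite -intr_Zp_eq0//; apply/eqP.
    by case: gE => /(congr1 (fun h => SL2_val h 0 1)); rewrite !mxE//= oppr0.
  have N0 : N%:Z%:~R = 0 :> 'Z_N by rewrite -[LHS]/(N%:R) pchar_Zp.
  rewrite /= /PSL2_reduction PSL2_map_pi; congr PSL2_pi; apply: val_inj.
  by apply: eq_mx2; rewrite !mxE /= ?rmorphD ?rmorphM ?rmorphXn /= ?N0
    ?expr0n ?mul0r ?addr0.
rewrite /bounded_gaps_group (lt_le_trans lte01 ge1)/=.
by rewrite (le_lt_trans leN)// ltry.
Qed.
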